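(* Let $\tau=m-1$. Every instance with $2$ agents and $m=4$ projects admits a budget-feasible solution which satisfies both agents.
   Context: An instance with $n$ agents and $m$ projects consists of demands $d^i_j\in[0,1]$ for $i\in[n]=\{1,\dots,n\}$ and $j\in[m]$, with $\sum_{j=1}^m d^i_j\le 1$ for every agent $i$. A solution is a vector $\mathbf{x}\in[0,1]^m$; it is budget-feasible if $\sum_{j=1}^m x_j\le 1$. Given a threshold $\tau$, agent $i$ is satisfied by $\mathbf{x}$ if the number of projects $j\in[m]$ with $x_j\ge d^i_j$ is at least $\tau$. *)

(* Defs.v *)
From HB Require Import structures.
From mathcomp Require Import all_boot all_order all_algebra.
Set Implicit Arguments.
Unset Strict Implicit.
Unset Printing Implicit Defensive.
Import Order.TTheory GRing.Theory Num.Theory.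
Local Open Scope ring_scope.

(* [d i j] is the demand
   d^i_j of agent [i] for project [j]. *)
Definition is_instance (R : realFieldType) (n m : nat) (d : 'M[R]_(n, m)) : Prop :=
  (forall i j, 0 <= d i j <= 1) /\ (forall i, \sum_(j < m) d i j <= 1).

Definition is_solution (R : realFieldType) (m : nat) (x : 'rV[R]_m) : Prop :=
  forall j, 0 <= x 0 j <= 1.

Definition budget_feasible (R : realFieldType) (m : nat) (x : 'rV[R]_m) : Prop :=
  \sum_(j < m) x 0 j <= 1.

Definition satisfied (R : realFieldType) (n m : nat) (d : 'M[R]_(n, m))
    (tau : nat) (x : 'rV[R]_m) (i : 'I_n) : Prop :=
  (tau <= #|[set j : 'I_m | (d i j <= x 0 j)%R]|)%N.

(* Main.v *)
Require Import Defs.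
From HB Require Import structures.
From mathcomp Require Import all_boot all_order all_algebra.
From mathcomp Require Import lra.
Import Order.TTheory GRing.Theory Num.Theory.
Local Open Scope ring_scope.

(** Write a and b for the two demand vectors. Funding every project at max(a_k, b_k) costs at most
    1 + min(P, N), where P and N are the sums of the positive and negative parts of a - b.
    Letting a give up the project with the largest positive part and b the one with the largest
    negative part saves at least P/p + N/q, where p and q count the positive and negative
    entries of a - b. If p, q > 0 then p + q <= 4 gives 1/p + 1/q >= 1, so the saving is at least
    min(P, N); otherwise min(P, N) = 0 already. *)

Definition giving_up {R : realFieldType} {m : nat} (d : 'M[R]_(2, m)) (i j : 'I_m) : 'rV[R]_m :=
  \row_k if k == i then d 1 k else if k == j then d 0 k else Num.max (d 0 k) (d 1 k).

Lemma giving_up_solution (R : realFieldType) (m : nat) (d : 'M[R]_(2, m)) (i j : 'I_m) :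
  is_instance d -> is_solution (giving_up d i j).
Proof.
move=> [d01 _] k; rewrite mxE.
by do 2 case: ifP => // _; rewrite /Num.max; case: ifP.
Qed.

Lemma satisfied_but_one (R : realFieldType) (n m : nat) (d : 'M[R]_(n, m))
    (x : 'rV[R]_m) (i : 'I_n) (k : 'I_m) :
  (forall j, j != k -> d i j <= x 0 j) -> satisfied d (m - 1)%N x i.
Proof.
move=> le_dx; rewrite /satisfied.
have -> : (m - 1 = #|[set~ k]|)%N by rewrite cardsC1 card_ord subn1.
by apply/subset_leq_card/subsetP => j; rewrite !inE; exact: le_dx.
Qed.

(** Agent 0 can miss its demand only on [i], agent 1 only on [j], even when [i = j]. *)
Lemma giving_up_satisfied (R : realFieldType) (m : nat) (d : 'M[R]_(2, m)) (i j : 'I_m)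
    (h : 'I_2) : satisfied d (m - 1)%N (giving_up d i j) h.
Proof.
have [-> | ->] : h = 0 \/ h = 1.
  by case: h => [[|[|//]] lt_h]; [left | right]; apply: val_inj.
- apply: (@satisfied_but_one _ _ _ _ _ _ i) => k /negPf ne_ki; rewrite mxE ne_ki.
  by case: ifP => // _; rewrite le_max lexx.
- apply: (@satisfied_but_one _ _ _ _ _ _ j) => k /negPf ne_kj; rewrite mxE ne_kj.
  by case: ifP => // _; rewrite le_max lexx orbT.
Qed.

Lemma exists_feasible_giving_up (R : realFieldType) (d : 'M[R]_(2, 4)) :
  is_instance d -> exists i j, budget_feasible (giving_up d i j).
Proof.
move=> [_ d_le1]; rewrite /budget_feasible.
(* By contradiction: if every pair is too costly, the largest positive and negative parts need not
   be located. *)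
have [/existsP[i /existsP[j le1]] | /existsPn no_pair] :=
  boolP [exists i, exists j, \sum_k giving_up d i j 0 k <= 1]; first by exists i, j.
have gt1 i j : 1 < \sum_k giving_up d i j 0 k.
  by have /existsPn/(_ j) := no_pair i; rewrite -ltNge.
(* Explicit ordinals let the index tests in [giving_up] compute. *)
pose o k lt_k : 'I_4 := @Ordinal 4 k lt_k.
have sum4 (F : 'I_4 -> R) : \sum_k F k = F (o 0%N isT) + F (o 1%N isT) + F (o 2%N isT) + F (o 3%N isT).
  rewrite !big_ord_recr big_ord0 /= add0r.
  by congr (F _ + F _ + F _ + F _); apply: val_inj.
move: (d_le1 0) (d_le1 1).
(* The twelve pairs of distinct indices suffice: entries of opposite sign sit at distinct indices,
   and if a - b has constant sign any pair costs at most 1. *)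
move: (gt1 (o 0%N isT) (o 1%N isT)) (gt1 (o 0%N isT) (o 2%N isT)) (gt1 (o 0%N isT) (o 3%N isT)).
move: (gt1 (o 1%N isT) (o 0%N isT)) (gt1 (o 1%N isT) (o 2%N isT)) (gt1 (o 1%N isT) (o 3%N isT)).
move: (gt1 (o 2%N isT) (o 0%N isT)) (gt1 (o 2%N isT) (o 1%N isT)) (gt1 (o 2%N isT) (o 3%N isT)).
move: (gt1 (o 3%N isT) (o 0%N isT)) (gt1 (o 3%N isT) (o 1%N isT)) (gt1 (o 3%N isT) (o 2%N isT)).
rewrite !sum4 !mxE /= {gt1 no_pair d_le1 sum4}.
move: (d 0 (o 0%N _)) (d 0 (o 1%N _)) (d 0 (o 2%N _)) (d 0 (o 3%N _)) => a0 a1 a2 a3.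
move: (d 1 (o 0%N _)) (d 1 (o 1%N _)) (d 1 (o 2%N _)) (d 1 (o 3%N _)) => b0 b1 b2 b3.
(* For a fixed sign pattern of a - b, averaging the costs over the pairs of a positive and a
   negative entry contradicts the hypotheses. *)
by case: (leP a0 b0) => ?; case: (leP a1 b1) => ?; case: (leP a2 b2) => ?;
  case: (leP a3 b3) => ? *; exfalso; lra.
Qed.

Theorem proposition2 (R : realFieldType) (m tau : nat) (hm : m = 4%N)
    (htau : tau = (m - 1)%N) (d : 'M[R]_(2, m)) (hd : is_instance d) :
  exists x : 'rV[R]_m,
    [/\ is_solution x, budget_feasible x & forall i : 'I_2, satisfied d tau x i].
Proof.
subst m tau.
have [i [j feasible]] := exists_feasible_giving_up _ _ hd.
exists (giving_up d i j); split=> //; first exact: giving_up_solution.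
exact: giving_up_satisfied.
Qed.
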